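(* Let $K$ be a field of characteristic zero, let $a_0(x),a_1(x),a_2(x)\in K[x]$, and let $D=y\partial_x+(a_2(x)y^2+a_1(x)y+a_0(x))\partial_y$, a $K$-derivation of $K[x,y]$. Then $D$ is simple if and only if the following three conditions hold: (1) $a_0(x)\in K^*$; (2) $\deg a_1(x)\geq 1$ or $\deg a_2(x)\geq 1$; (3) there exists no $l\in K^*$ such that $a_2(x)=l\,a_1(x)-l^2a_0(x)$.
   Context: $K^*=K\setminus\{0\}$ (viewed inside $K[x]$ as the nonzero constants), $\deg 0=-\infty$, and $\partial_x,\partial_y$ are the partial derivatives on $K[x,y]$. A $K$-derivation $D$ of $K[x,y]$ is a $K$-linear map satisfying $D(ab)=D(a)b+aD(b)$. An ideal $I$ is $D$-stable if $D(I)\subset I$. $D$ is called simple if $K[x,y]$ has no $D$-stable ideals other than $0$ and $K[x,y]$. *)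

(* Defs.v *)
From HB Require Import structures.
From mathcomp Require Import all_boot all_algebra.
From mathcomp Require Import classical_sets.

Set Implicit Arguments.
Unset Strict Implicit.
Unset Printing Implicit Defensive.

Import GRing.Theory.

Local Open Scope ring_scope.
Local Open Scope classical_set_scope.

(* K[x,y] is represented as {poly {poly K}}, that is K[x][y]: the outer
   indeterminate 'X is y, the inner one 'X%:P is x, a polynomial a(x) in K[x]
   is a%:P, and c in K acts by scaling by c%:P : {poly K}.                    *)

Definition partial_x (K : fieldType) (p : {poly {poly K}}) : {poly {poly K}} :=
  map_poly (@deriv K) p.

Definition partial_y (K : fieldType) (p : {poly {poly K}}) : {poly {poly K}} :=
  p^`().

Definition is_derivation (K : fieldType)
    (D : {poly {poly K}} -> {poly {poly K}}) : Prop :=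
  (forall (c : K) (p q : {poly {poly K}}),
     D (c%:P *: p + q) = c%:P *: D p + D q)
  /\ (forall p q : {poly {poly K}}, D (p * q) = D p * q + p * D q).

Definition is_ideal (R : comNzRingType) (I : set R) : Prop :=
  [/\ I 0, forall p q : R, I p -> I q -> I (p + q)
    & forall r p : R, I p -> I (r * p)].

Definition stable (R : comNzRingType) (D : R -> R) (I : set R) : Prop :=
  D @` I `<=` I.

Definition simple_derivation (K : fieldType)
    (D : {poly {poly K}} -> {poly {poly K}}) : Prop :=
  is_derivation D /\
  forall I : set {poly {poly K}},
    is_ideal I -> stable D I -> I = [set 0] \/ I = setT.

Definition quadratic_derivation (K : fieldType) (a0 a1 a2 : {poly K})
    (p : {poly {poly K}}) : {poly {poly K}} :=
  'X * partial_x p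
  + (a2%:P * 'X ^+ 2 + a1%:P * 'X + a0%:P) * partial_y p.

Lemma partial_xE (K : fieldType) (p : {poly {poly K}}) (i : nat) :
  (partial_x p)`_i = (p`_i)^`().
Proof. by rewrite coef_map_id0 // linear0. Qed.

Lemma partial_x_is_derivation (K : fieldType) : is_derivation (@partial_x K).
Proof.
split=> [c p q | p q]; apply/polyP=> i; rewrite !(coefD, coefZ, partial_xE).
  by rewrite derivD derivM derivC mul0r add0r.
rewrite !coefM raddf_sum -big_split /=.
by apply: eq_bigr => j _; rewrite !partial_xE derivM.
Qed.

Lemma quadratic_derivation_is_derivation (K : fieldType) (a0 a1 a2 : {poly K}) :
  is_derivation (quadratic_derivation a0 a1 a2).
Proof.
have [dxL dxM] := partial_x_is_derivation K.
split=> [c p q | p q]; rewrite /quadratic_derivation /partial_y.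
all: move: (a2%:P * _ + _ + _) => b.
  by rewrite dxL derivD derivZ !mulrDr scalerDr !scalerAr addrACA.
rewrite dxM derivM !mulrDr mulrDl !mulrA addrACA.
by rewrite (mulrC p 'X) (mulrC p b).
Qed.

Lemma quadratic_derivation_x (K : fieldType) (a0 a1 a2 : {poly K}) :
  quadratic_derivation a0 a1 a2 'X%:P = 'X.
Proof.
rewrite /quadratic_derivation /partial_y derivC mulr0 addr0.
suff -> : partial_x ('X%:P : {poly {poly K}}) = 1 by rewrite mulr1.
apply/polyP=> i; rewrite partial_xE coefC coef1.
by case: (i == 0)%N; rewrite ?derivX ?linear0.
Qed.

Lemma quadratic_derivation_y (K : fieldType) (a0 a1 a2 : {poly K}) :
  quadratic_derivation a0 a1 a2 'X
  = a2%:P * 'X ^+ 2 + a1%:P * 'X + a0%:P.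
Proof.
rewrite /quadratic_derivation /partial_y derivX mulr1.
suff -> : partial_x ('X : {poly {poly K}}) = 0 by rewrite mulr0 add0r.
apply/polyP=> i; rewrite partial_xE coefX coef0.
by case: (i == 1)%N; rewrite -?polyC1 ?derivC ?linear0.
Qed.

(* Main.v *)
Require Import Defs.
From mathcomp Require Import all_boot all_algebra.
From mathcomp Require Import boolp classical_sets ring zify.

(** Write [D] for the derivation, [x] for the inner and [y] for the outer
    indeterminate.

    Necessity.  For every [a0] the polynomials whose constant term in [y] is a
    multiple of [a0] form a [D]-stable ideal, so [a0] has to be a nonzero
    constant [c].  If [D] is simple, a nonzero Darboux polynomial (an [f]
    dividing [D f]) is a unit.  If [a1] and [a2] are constants then [D y] is a Darboux
    polynomial, and when it is itself constant [y ^ 2 - 2 c x] is a constant of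
    [D]; if [a2 = l a1 - l ^ 2 a0] then [1 + l y] is a Darboux polynomial.

    Sufficiency has two halves.  First, if no polynomial of positive degree in
    [y] is Darboux, then a nonzero stable ideal contains [1]
    ([stable_ideal_unit]).  Pass to the radical, which is stable in
    characteristic zero.  Pseudo-dividing [D g] by an element [g] of the ideal
    either gives an element of smaller degree in [y], or shows that [g] divides
    a multiple [k(x) D g]; in that case, by Gauss's lemma, the primitive part
    of [g] is a Darboux polynomial, so [g] lies in [K[x]].  An element [p] of
    the ideal in [K[x]] yields [D p = p' y], then [c p' ^ 2] modulo this element
    by applying [D] once more, hence [p'], of smaller degree.

    Secondly, when [a1] or [a2] is not constant, a Darboux polynomial of degree
    [n > 0] in [y] forces a relation [a2 = l a1 - l ^ 2 c] with [l] nonzero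
    ([darboux_system_exceptional]).  Comparison of
    degrees shows that the leading coefficient is a constant, say [1], and that
    the cofactor is [n a2 y + L] with [L] in [K[x]].  The coefficients [g k]
    satisfy a three-term recurrence, which can be solved from [g 0] upwards
    (dividing by [c]) or from [g n = 1] downwards (dividing by [a2], or
    integrating when [a2 = 0]).  Both directions give exact degrees and leading
    coefficients in [x].
    - If [deg a1 < deg a2], then the downward direction produces negative
      degrees at once.
    - If [deg a1 = deg a2], then all [g k] are constants, and the recurrence
      becomes the relation [a2 = l a1 - l ^ 2 c].
    - If [deg a2 < deg a1], then the upward direction has a turning point [mu]:
      the leading coefficient of [L] is [mu] times that of [a1], with
      [0 <= mu <= n], for otherwise [g (n + 1)] would not vanish.  At [mu] both
      directions describe the same [g mu] ([matching]).  The recurrence next to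
      [mu] then contradicts the leading coefficients when [a2 = 0]; otherwise
      it gives [n = 2 mu] and [a2] constant, and the next order term of the
      recurrence at [mu] is contradictory.
    Analytically, [mu] counts the branches of [g = 0] with [y] asymptotic to
    [- c / a1] as [x] tends to infinity, and [n - mu] the other branches. *)

Set Implicit Arguments.
Unset Strict Implicit.
Unset Printing Implicit Defensive.

Import GRing.Theory.

Local Open Scope ring_scope.

(** * Degrees and coefficients of univariate polynomials *)

Section DegreeBounds.
Variable K : fieldType.
Implicit Types p q r : {poly K}.

Lemma coef_size_le p i : (size p <= i)%N -> p`_i = 0.
Proof. exact: nth_default. Qed.

(** The bounds [a] and [b] need not be attained: the coefficient may vanish, so
    that upper bounds on degrees propagate together with leading terms. *)
Lemma coefM_size p q a b : (size p <= a.+1)%N -> (size q <= b.+1)%N ->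
  (p * q)`_(a + b) = p`_a * q`_b.
Proof.
move=> sp sq; rewrite coefM.
have ha : (a < (a + b).+1)%N by lia.
rewrite (bigD1 (Ordinal ha)) //= [X in _ + X]big1 ?addr0; first by rewrite addKn.
move=> i /eqP ne; have {}ne : nat_of_ord i <> a by move=> e; apply: ne; apply: val_inj.
have [lt | ge] := ltnP i a.
  by rewrite [q`__]coef_size_le ?mulr0 //; lia.
by rewrite [p`__]coef_size_le ?mul0r //; lia.
Qed.

Lemma size_mul_le p q a b : (size p <= a.+1)%N -> (size q <= b.+1)%N ->
  (size (p * q)%R <= (a + b).+1)%N.
Proof. by move=> sp sq; apply: leq_trans (size_polyMleq _ _) _; move: sp sq; lia. Qed.

Lemma size_add_le p q a : (size p <= a)%N -> (size q <= a)%N ->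
  (size (p + q)%R <= a)%N.
Proof. by move=> sp sq; apply: leq_trans (size_polyD _ _) _; rewrite geq_max sp. Qed.

Lemma size_sub_le p q a : (size p <= a)%N -> (size q <= a)%N ->
  (size (p - q)%R <= a)%N.
Proof. by move=> sp sq; apply: size_add_le; rewrite ?size_polyN. Qed.

Lemma size_muln_le p n a : (size p <= a)%N -> (size (p *+ n)%R <= a)%N.
Proof.
move=> sp; elim: n => [|n IH]; first by rewrite mulr0n size_poly0.
by rewrite mulrS; apply: size_add_le.
Qed.

Lemma size_C_le (c : K) p a : (size p <= a)%N -> (size (c%:P * p)%R <= a)%N.
Proof. by rewrite mul_polyC => sp; apply: leq_trans (size_scale_leq _ _) sp. Qed.

Lemma size_mulE p q : p != 0 -> q != 0 ->
  size (p * q) = (size p + size q).-1.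
Proof. exact: size_mul. Qed.

Lemma size_deriv_le p a : (size p <= a.+1)%N -> (size p^`() <= a)%N.
Proof.
move=> sp; have [-> | p0] := eqVneq p 0; first by rewrite linear0 size_poly0.
by have := lt_size_deriv p0; lia.
Qed.

Lemma size_eq_coef p a : (size p <= a.+1)%N -> p`_a != 0 -> size p = a.+1.
Proof.
move=> sp pa; apply/eqP; rewrite eqn_leq sp ltnNge.
by apply: contra pa => le; rewrite coef_size_le.
Qed.

End DegreeBounds.

Section CharZero.
Variable K : fieldType.
Hypothesis charK0 : [pchar K] =i pred0.
Implicit Types p q r : {poly K}.

Lemma natrK_eq0 n : (n%:R == 0 :> K) = (n == 0)%N.
Proof. by have /pcharf0P -> := charK0. Qed.

Lemma natrK_inj (m n : nat) : m%:R = n%:R :> K -> m = n.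
Proof.
wlog le : m n / (m <= n)%N.
  by move=> W; case: (leqP m n) => [|/ltnW] le e; [apply: W | apply/esym/W].
move=> e; have : (n - m)%:R == 0 :> K by rewrite natrB // e subrr.
by rewrite natrK_eq0 => /eqP; lia.
Qed.

Lemma size_deriv_char0 p : size p^`() = (size p).-1.
Proof.
case e : (size p) => [|n] /=.
  by move/eqP: e; rewrite size_poly_eq0 => /eqP ->; rewrite linear0 size_poly0.
case: n e => [|n] e.
  by have [c _ ->] := size_poly1P p (introT eqP e); rewrite derivC size_poly0.
apply: size_eq_coef; first by apply: size_deriv_le; rewrite e.
rewrite coef_deriv -mulr_natr mulf_neq0 ?natrK_eq0 //.
by have := lead_coef_eq0 p; rewrite lead_coefE e -size_poly_eq0 e => ->.
Qed.

Lemma size_mulrnS p n : size (p *+ n.+1) = size p.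
Proof. by rewrite -scaler_nat size_scale // natrK_eq0. Qed.

(** The terms [p^`()] and [q * p *+ j.+1] cannot cancel, the second having the
    larger degree; so the degree of [p] is known from those of [q] and [r]. *)
Lemma size_riccati q p r j : q != 0 -> p != 0 ->
  p^`() = q * p *+ j.+1 + r -> size r = (size q + size p).-1.
Proof.
move=> q0 p0 e; have -> : r = p^`() - q * p *+ j.+1 by rewrite e; ring.
have sM : size (q * p *+ j.+1) = (size q + size p).-1.
  by rewrite size_mulrnS size_mulE.
rewrite addrC size_polyDl ?size_polyN sM //.
have := lt_size_deriv p0.
have : (0 < size q)%N by rewrite size_poly_gt0.
lia.
Qed.

End CharZero.

(** * The recurrence for the coefficients of a Darboux polynomial *)

(** With [g k] the coefficient of [y ^ k], these are the coefficients of
    [D f = (n a2 y + L) f] for [f] monic in [y] of degree [n].  The index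
    [j = n - k] avoids subtractions. *)
Definition darboux_system (K : fieldType) (c : K) (a1 a2 L : {poly K}) (n : nat)
    (g : nat -> {poly K}) : Prop :=
  [/\ g n = 1, forall k, (n < k)%N -> g k = 0, L * g 0%N = c%:P * g 1%N
    & forall k j, (k + j)%N = n ->
      (g k)^`() = a2 * g k *+ j + (L - a1 *+ k.+1) * g k.+1
                  - c%:P * g k.+2 *+ k.+2].

Section DarbouxSystem.
Variable K : fieldType.
Hypothesis charK0 : [pchar K] =i pred0.
Variables (c : K) (a1 a2 L : {poly K}) (n : nat) (g : nat -> {poly K}).
Hypotheses (c0 : c != 0) (n_gt0 : (0 < n)%N).
Hypothesis sys : darboux_system c a1 a2 L n g.

Let gn : g n = 1. Proof. by case: sys. Qed.
Let g_big k : (n < k)%N -> g k = 0. Proof. by case: sys => _ + _ _; apply. Qed.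
Let E0 : L * g 0%N = c%:P * g 1%N. Proof. by case: sys. Qed.
Let E k j : (k + j)%N = n ->
  (g k)^`() = a2 * g k *+ j + (L - a1 *+ k.+1) * g k.+1 - c%:P * g k.+2 *+ k.+2.
Proof. by case: sys => _ _ _; apply. Qed.

Let up k j : (k + j)%N = n ->
  c%:P * g k.+2 *+ k.+2 = a2 * g k *+ j + (L - a1 *+ k.+1) * g k.+1 - (g k)^`().
Proof. by move=> e; rewrite (E e); ring. Qed.

Let cPM p : c%:P * p = 0 -> p = 0.
Proof. by move=> /eqP; rewrite mulf_eq0 polyC_eq0 (negPf c0) => /eqP. Qed.

Let natM_eq0 k (p : {poly K}) : p *+ k.+1 = 0 -> p = 0.
Proof. by move=> /eqP; rewrite -scaler_nat scaler_eq0 natrK_eq0 // => /eqP. Qed.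

Lemma g0_neq0 : g 0%N != 0.
Proof.
apply/eqP => g0.
have zero k : g k = 0 /\ g k.+1 = 0.
  elim: k => [|k [IH1 IH2]].
    by split=> //; apply: cPM; rewrite -E0 g0 mulr0.
  split=> //; have [lt | le] := ltnP n k.+2; first exact: g_big.
  apply/cPM/(@natM_eq0 k.+1); rewrite (@up k (n - k)); last by lia.
  by rewrite IH1 IH2 !mulr0 mul0rn linear0 subr0 addr0.
by have := oner_neq0 {poly K}; rewrite -gn (zero n).1 eqxx.
Qed.

Let m := (size (g 0%N)).-1.

Let sg0 : size (g 0%N) = m.+1.
Proof. by rewrite prednK // size_poly_gt0 g0_neq0. Qed.

(** Solving upwards from [g 0]: as long as [c] is constant and [a2] has degree
    less than [2 * d], the term with [a1] and [L] governs the growth, by at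
    most [d] at each step. *)
Section Bottom.
Variable d : nat.
Hypotheses (d_gt0 : (0 < d)%N) (sL : (size L <= d.+1)%N)
  (sa1 : (size a1 <= d.+1)%N) (sa2 : (size a2 <= d.*2)%N).

Let sLa k : (size (L - a1 *+ k)%R <= d.+1)%N.
Proof. by apply: size_sub_le => //; apply: size_muln_le. Qed.

Let bottom_step k : (size (g k) <= (m + k * d).+1)%N ->
  (size (g k.+1) <= (m + k.+1 * d).+1)%N -> (k < n)%N ->
  (size (g k.+2) <= (m + k.+2 * d).+1)%N /\
  c * (g k.+2)`_(m + k.+2 * d) *+ k.+2
    = (L`_d - a1`_d *+ k.+1) * (g k.+1)`_(m + k.+1 * d).
Proof.
move=> s1 s2 lt; have e : (k + (n - k) = n)%N by lia.
have s3 : (size ((L - a1 *+ k.+1) * g k.+1)%R <= (m + k.+2 * d).+1)%N.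
  by have := size_mul_le (sLa k.+1) s2; congr (_ <= _)%N; lia.
have s4 : (size (a2 * g k *+ (n - k))%R <= m + k.+2 * d)%N.
  have sa2' : (size a2 <= d.*2.-1.+1)%N by rewrite prednK // double_gt0.
  by apply/size_muln_le/(leq_trans (size_mul_le sa2' s1)); lia.
have s5 : (size (g k)^`() <= m + k.+2 * d)%N.
  by apply: leq_trans (size_deriv_le s1) _; lia.
have s6 : (size (c%:P * g k.+2 *+ k.+2)%R <= (m + k.+2 * d).+1)%N.
  by rewrite (up e); apply: size_sub_le; [apply: size_add_le|]; lia.
split; first by move: s6; rewrite size_mulrnS // mul_polyC size_scale.
have e1 : (m + k.+2 * d = d + (m + k.+1 * d))%N by lia.
have := congr1 (fun p : {poly K} => p`_(m + k.+2 * d)) (up e).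
rewrite coefMn coefCM coefB coefD => ->.
rewrite (coef_size_le s4) (coef_size_le s5) add0r subr0 {1}e1 coefM_size //.
by rewrite coefB coefMn.
Qed.

Lemma bottom_bounds k : (size (g k) <= (m + k * d).+1)%N /\
  ((k <= n)%N -> c * (g k.+1)`_(m + k.+1 * d) *+ k.+1
    = (L`_d - a1`_d *+ k) * (g k)`_(m + k * d)).
Proof.
have base : (size (g 1%N) <= (m + 1 * d).+1)%N /\
    c * (g 1%N)`_(m + 1 * d) = L`_d * (g 0%N)`_m.
  have s0 : (size (g 0%N) <= m.+1)%N by rewrite sg0.
  split; last first.
    have := congr1 (fun p : {poly K} => p`_(d + m)) E0.
    by rewrite coefCM coefM_size // mul1n addnC => ->.
  have -> : size (g 1%N) = size (L * g 0%N)%R by rewrite E0 mul_polyC size_scale.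
  by apply: leq_trans (size_mul_le sL s0) _; lia.
have sizes i : (size (g i) <= (m + i * d).+1)%N /\
    (size (g i.+1) <= (m + i.+1 * d).+1)%N.
  elim: i => [|i [s1 s2]]; first by rewrite mul0n addn0 sg0; case: base.
  split=> //; have [lt | le] := ltnP i n; first by case: (bottom_step s1 s2 lt).
  by rewrite g_big ?size_poly0 //; lia.
split=> [|le]; first by case: (sizes k).
case: k le => [|k] le; first by rewrite mul0n addn0 mulr0n subr0 mulr1n; case: base.
by case: (sizes k) => s1 s2; case: (bottom_step s1 s2 le).
Qed.

Lemma bottom_size k : (size (g k) <= (m + k * d).+1)%N.
Proof. by case: (bottom_bounds k). Qed.

Lemma bottom_coef k : (k <= n)%N -> c * (g k.+1)`_(m + k.+1 * d) *+ k.+1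
    = (L`_d - a1`_d *+ k) * (g k)`_(m + k * d).
Proof. by case: (bottom_bounds k). Qed.

Lemma bottom_coef_neq0 mu : (mu <= n.+1)%N ->
  (forall k, (k < mu)%N -> L`_d <> a1`_d *+ k) ->
  (g mu)`_(m + mu * d) != 0.
Proof.
elim: mu => [|k IH] le ne.
  by rewrite mul0n addn0 -lead_coefE lead_coef_eq0 g0_neq0.
have {IH} nz : (g k)`_(m + k * d) != 0.
  by apply: IH => [|i lt]; [lia | apply: ne; lia].
apply/eqP => z; have := bottom_coef le; rewrite z mulr0 mul0rn.
move/esym/eqP; rewrite mulf_eq0 (negPf nz) orbF subr_eq0 => /eqP.
exact: ne.
Qed.

(** If the leading coefficient avoided all these multiples, then the growth would
    never stop and [g n.+1] would be nonzero. *)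
Lemma leading_cofactor : exists2 mu, (mu <= n)%N & L`_d = a1`_d *+ mu.
Proof.
have [/existsP [mu /eqP e] | none] :=
    boolP [exists mu : 'I_n.+1, L`_d == a1`_d *+ mu].
  by exists mu; rewrite // -ltnS.
have /eqP[] : (g n.+1)`_(m + n.+1 * d) != 0.
  apply: bottom_coef_neq0 => // k lt e; case/existsP: none.
  by exists (Ordinal lt); apply/eqP.
by rewrite g_big // coef0.
Qed.

End Bottom.

(** A cofactor of larger degree [s] would contradict [leading_cofactor] at [s],
    where the coefficient of [a1] is zero. *)
Lemma size_cofactor d : (0 < d)%N -> (size a1 <= d)%N -> (size a2 <= d.*2)%N ->
  (size L <= d)%N.
Proof.
move=> d0 s1 s2; rewrite leqNgt; apply/negP => lt.
set s := (size L).-1.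
have eL : size L = s.+1 by rewrite /s; lia.
have ds : (d <= s)%N by lia.
have [||||mu _ e] := @leading_cofactor s; rewrite ?eL //; try lia.
have : lead_coef L = 0.
  by rewrite lead_coefE -/s e coef_size_le ?mul0rn //; lia.
by move/eqP; rewrite lead_coef_eq0 -size_poly_eq0 eL.
Qed.

(** Downwards, [g n.-1] would have negative degree, so it vanishes and
    [L = n a1]; then [g n.-2] also vanishes, and the equation between [g n.-2]
    and [g n] reduces to [n c = 0]. *)
Lemma no_system_a1_lt_a2 : (size a1 < size a2)%N -> (1 < size a2)%N -> False.
Proof.
move=> lt12 gt1.
have sL : (size L <= (size a2).-1)%N by apply: size_cofactor; lia.
have a20 : a2 != 0 by rewrite -size_poly_gt0; lia.
have noroot k j (r : {poly K}) : (size r < size a2)%N ->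
    (g k)^`() = a2 * g k *+ j.+1 + r -> g k = 0.
  move=> sr e; apply/eqP; apply/negPn/negP => nz.
  have := size_riccati charK0 a20 nz e.
  by have : (0 < size (g k))%N; [rewrite size_poly_gt0 | lia].
have e1 : (n.-1 + 1 = n)%N by lia.
have sr : (size (L - a1 *+ n)%R < size a2)%N.
  by rewrite -(prednK (ltnW gt1)) ltnS; apply: size_sub_le => //; apply: size_muln_le; lia.
have Er : (g n.-1)^`() = a2 * g n.-1 *+ 1 + (L - a1 *+ n).
  by rewrite (E e1) prednK // gn (g_big (ltnSn n)); ring.
have gn1 := noroot _ _ _ sr Er.
have eL : L - a1 *+ n = 0 by move: Er; rewrite gn1 linear0 mulr0 mul0rn add0r.
case: (posnP n.-1) => [n1 | n2].
  by have := g0_neq0; rewrite -n1 gn1 eqxx.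
have e2 : (n.-2 + 2 = n)%N by lia.
have sc : (size (- (c%:P * (1 : {poly K}) *+ n))%R < size a2)%N.
  rewrite size_polyN; apply: leq_ltn_trans gt1.
  by apply/size_muln_le/size_C_le; rewrite size_poly1.
have Er2 : (g n.-2)^`() = a2 * g n.-2 *+ 2 + - (c%:P * (1 : {poly K}) *+ n).
  rewrite (E e2); have -> : n.-2.+1 = n.-1 by lia.
  rewrite (_ : n.-1.+1 = n); last by lia.
  by rewrite gn1 gn mulr0 addr0.
have := Er2; rewrite (noroot _ _ _ sc Er2) linear0 mulr0 mul0rn add0r => /esym/eqP.
rewrite oppr_eq0 -(prednK n_gt0) => /eqP /natM_eq0 /cPM /eqP.
by rewrite oner_eq0.
Qed.

(** All [g k] are constants, so the recurrence at [k = n - 1] expresses [a2] as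
    an affine combination of [a1] and [1]; the recurrence at [k = 0], compared
    in the degree of [a1], determines the constant term. *)
Lemma system_a1_eq_a2 : size a1 = size a2 -> (1 < size a1)%N ->
  exists2 l : K, l != 0 & a2 = l *: a1 - (l ^+ 2 * c)%:P.
Proof.
move=> e12 gt1; set d := (size a1).-1.
have ed : size a1 = d.+1 by rewrite /d; lia.
have sL : (size L <= d.+1)%N by apply: size_cofactor; lia.
have a20 : a2 != 0 by rewrite -size_poly_gt0; lia.
have consts j : (j <= n)%N -> (size (g (n - j))%R <= 1)%N /\ (size (g (n - j).+1)%R <= 1)%N.
  elim: j => [|j IH] le; first by rewrite subn0 gn size_poly1 g_big ?size_poly0.
  have [|s1 s2] := IH; first by lia.
  have eS : ((n - j.+1).+1 = n - j)%N by lia.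
  rewrite eS; split=> //.
  have [-> | nz] := eqVneq (g (n - j.+1)) 0; first by rewrite size_poly0.
  have e : (n - j.+1 + j.+1 = n)%N by lia.
  have Ek := E e; rewrite -addrA eS in Ek.
  have := size_riccati charK0 a20 nz Ek.
  rewrite -e12 ed; move=> es.
  have : (size ((L - a1 *+ (n - j)) * g (n - j) - c%:P * g (n - j).+1 *+ (n - j).+1)%R <= d.+1)%N.
    apply: size_sub_le.
      rewrite -[d.+1]/(d.+1) -(addn0 d); apply: size_mul_le => //.
      by apply: size_sub_le => //; apply: size_muln_le; rewrite ed.
    by apply: size_muln_le; apply: size_C_le; apply: leq_trans s2 _.
  by rewrite es; have : (0 < size (g (n - j.+1)))%N; [rewrite size_poly_gt0 | lia].
have gC k : g k = ((g k)`_0)%:P.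
  apply: size1_polyC; have [le | lt] := leqP k n; last by rewrite g_big ?size_poly0.
  by have [] := consts (n - k)%N _; [lia | have -> : (n - (n - k) = k)%N by lia].
have gD k : (g k)^`() = 0 by rewrite gC derivC.
move: g0_neq0; rewrite (gC 0%N) polyC_eq0.
set g00 := (g 0%N)`_0 => g00n0.
set b := (g n.-1)`_0; set g10 := (g 1%N)`_0.
have LC : L = (c * g10 / g00)%:P.
  have := E0; rewrite (gC 0%N) (gC 1%N) -/g00 -/g10 -polyCM => eL.
  apply: (mulIf (_ : g00%:P != 0)); first by rewrite polyC_eq0.
  by rewrite eL -polyCM divfK.
have Etop : a2 * b%:P + (L - a1 *+ n) = 0.
  have e1 : (n.-1 + 1 = n)%N by lia.
  have := E e1; rewrite gD prednK // gn (g_big (ltnSn n)) (gC n.-1) -/b => /esym.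
  by move=> <-; ring.
have coefd (p : {poly K}) : (size p <= 1)%N -> p`_d = 0.
  by move=> sp; apply: coef_size_le; lia.
have Ld : L`_d = 0 by rewrite LC coefd // size_polyC_leq1.
have a1d : a1`_d != 0 by rewrite -lead_coefE lead_coef_eq0 -size_poly_eq0 ed.
have topd : a2`_d * b = a1`_d *+ n.
  have := congr1 (fun p : {poly K} => p`_d) Etop.
  by rewrite coefD coefB coefMn coefMC Ld coef0 => /eqP; rewrite sub0r subr_eq0 => /eqP.
have nK : n%:R != 0 :> K by rewrite natrK_eq0 // -lt0n.
have b0 : b != 0.
  apply: contra_neq nK => b0; apply: (mulfI a1d).
  by rewrite mulr0 mulr_natr -topd b0 mulr0.
have botd : a2`_d * g00 *+ n = a1`_d * g10.
  have e1 : (0 + n = n)%N by lia.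
  have := congr1 (fun p : {poly K} => p`_d) (E e1).
  rewrite gD coef0 coefB coefD !coefMn.
  rewrite (gC 0%N) (gC 1%N) (gC 2%N) -/g00 -/g10 !coefMC coefB coefMn Ld mulr1n.
  rewrite [c%:P`__]coefd ?size_polyC_leq1 // mul0r mul0rn => e.
  by apply/eqP; rewrite -subr_eq0; apply/eqP; rewrite [RHS]e; ring.
have a2d : a2`_d = a1`_d * n%:R / b by apply: (mulIf b0); rewrite topd divfK // mulr_natr.
have g10E : g10 = g00 * n%:R ^+ 2 / b.
  by apply: (mulfI a1d); rewrite -botd a2d; field.
exists (n%:R / b); first by rewrite mulf_neq0 ?invr_eq0.
apply: (mulIf (_ : b%:P != 0)); first by rewrite polyC_eq0.
have -> : a2 * b%:P = a1 *+ n - L by rewrite -[LHS]subr0 -Etop; ring.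
rewrite LC g10E; set l := n%:R / b; set t := l ^+ 2 * c.
have -> : (l *: a1 - t%:P) * b%:P = (l * b) *: a1 - (t * b)%:P.
  by rewrite -!mul_polyC !polyCM; ring.
rewrite /t /l divfK // scaler_nat; congr (_ - _).
by congr (_%:P); field; rewrite b0 g00n0.
Qed.


Section A1Dominant.
Variable d : nat.
Hypotheses (d_gt0 : (0 < d)%N) (sa1 : size a1 = d.+1) (sa2 : (size a2 <= d)%N).

Let sL : (size L <= d.+1)%N. Proof. by apply: size_cofactor; lia. Qed.
Let sa1' : (size a1 <= d.+1)%N. Proof. by rewrite sa1. Qed.
Let sa2' : (size a2 <= d.*2)%N. Proof. by apply: leq_trans sa2 _; lia. Qed.

Let sLa k : (size (L - a1 *+ k)%R <= d.+1)%N.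
Proof. by apply: size_sub_le => //; apply: size_muln_le. Qed.

Let alpha := a1`_d.

Let alpha0 : alpha != 0.
Proof. by have := lead_coef_eq0 a1; rewrite lead_coefE sa1 -size_poly_eq0 sa1 => ->. Qed.

(** One downward step of the recurrence, abstracted from how it is solved: the
    degree grows by at most [e], and the leading coefficient is divided by [b] (and by [j.+1]).
    When [a2] is nonzero the term [a2 * p] is inverted, with [b] its leading
    coefficient; when [a2 = 0] the derivative is integrated, which corresponds to
    [e = d + 1] and [b = - e]. *)
Definition balanced (e : nat) (b : K) := forall j (p r : {poly K}),
  p^`() = a2 * p *+ j.+1 + r -> (size r <= (d + j * e).+1)%N ->
  (size p <= (j.+1 * e).+1)%N /\ b * p`_(j.+1 * e) *+ j.+1 = - r`_(d + j * e).

Lemma balanced_a2_neq0 d2 e : size a2 = d2.+1 -> d = (d2 + e)%N ->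
  balanced e a2`_d2.
Proof.
move=> s2 de j p r eq sr.
have a20 : a2 != 0 by rewrite -size_poly_gt0 s2.
have sp : (size p <= (j.+1 * e).+1)%N.
  have [-> | p0] := eqVneq p 0; first by rewrite size_poly0.
  by have := size_riccati charK0 a20 p0 eq; move: sr; rewrite s2 => ? ?; lia.
split=> //.
have ei : (d + j * e = d2 + j.+1 * e)%N by lia.
have -> : r = p^`() - a2 * p *+ j.+1 by rewrite eq; ring.
have z : p^`()`_(d2 + j.+1 * e) = 0.
  by apply/coef_size_le/(leq_trans (size_deriv_le sp)); lia.
by rewrite ei coefB coefMn coefM_size ?s2 // z sub0r opprK.
Qed.

Lemma balanced_a2_eq0 : a2 = 0 -> balanced d.+1 (- d.+1%:R).
Proof.
move=> a20 j p r; rewrite a20 mul0r mul0rn add0r => <- sr.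
have ei : ((d + j * d.+1).+1 = j.+1 * d.+1)%N by lia.
split; first by move: sr; rewrite size_deriv_char0 //; lia.
by rewrite coef_deriv -ei; ring.
Qed.

Section Matching.
Variables (e : nat) (b : K).
Hypotheses (e_gt0 : (0 < e)%N) (b0 : b != 0) (bal : balanced e b).

Let top_step j k : (k + j.+1 = n)%N -> (size (g k.+1) <= (j * e).+1)%N ->
  (size (g k.+2) <= (j * e).+1)%N ->
  (size (g k) <= (j.+1 * e).+1)%N /\
  b * (g k)`_(j.+1 * e) *+ j.+1 = (alpha *+ k.+1 - L`_d) * (g k.+1)`_(j * e).
Proof.
move=> ek s1 s2; have := E ek; rewrite -addrA => /bal.
have sc : (size (c%:P * g k.+2 *+ k.+2)%R <= d + j * e)%N.
  by apply/size_muln_le/size_C_le/(leq_trans s2); lia.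
case=> [|sk ->].
  by apply: size_sub_le; [exact: size_mul_le (sLa k.+1) s1 | exact: leqW].
split=> //; rewrite coefB (coef_size_le sc) subr0 coefM_size //.
by rewrite coefB coefMn -mulNr opprB.
Qed.

Let top_size j k : (k + j = n)%N -> (size (g k) <= (j * e).+1)%N.
Proof.
suff /(_ j k) W : forall j k, (k + j = n)%N ->
    (size (g k) <= (j * e).+1)%N /\ (size (g k.+1) <= (j * e).+1)%N.
  by move=> ek; case: (W ek).
elim=> [|i IH] l el.
  have -> : l = n by lia.
  by rewrite gn size_poly1 g_big ?size_poly0 //.
have [|s1 s2] := IH l.+1; first by lia.
split; first by case: (top_step el s1 s2).
by apply: leq_trans s1 _; lia.
Qed.

Let top_coef j k : (k + j.+1 = n)%N ->
  b * (g k)`_(j.+1 * e) *+ j.+1 = (alpha *+ k.+1 - L`_d) * (g k.+1)`_(j * e).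
Proof.
move=> ek; have s1 : (size (g k.+1) <= (j * e).+1)%N by apply: top_size; lia.
apply: (top_step ek s1 _).2; case: j ek {s1} => [|j] ek.
  by rewrite g_big ?size_poly0 //; lia.
by have : (size (g k.+2) <= (j * e).+1)%N; [apply: top_size|]; lia.
Qed.

(** Let [M] be the turning point.  The upward solution keeps its expected degree
    up to [M], the downward one from [n] to [M]; equating the two degrees of
    [g M] gives [N].  An end point, [M = 0] or [M = n], would give incompatible
    degrees.  The recurrence for the derivative of [g (M - 1)] has only terms of
    degree less than [N] besides [(L - M a1) (g M)], hence [L = M a1].  The
    statement writes [mu.+1] for [M] and [nu.+1] for [n - M]. *)
Lemma matching : exists mu nu, let N := (nu.+1 * e)%N in
  [/\ n = (mu.+1 + nu.+1)%N, (m + mu.+1 * d = N)%N, L = a1 *+ mu.+1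
    & [/\ (g mu.+1)`_N != 0,
          c * (g mu.+1)`_N *+ mu.+1 = alpha * (g mu)`_(m + mu * d),
          b * (g mu.+1)`_N *+ nu.+1 = alpha * (g mu.+2)`_(nu * e),
          forall k, (size (g k) <= (m + k * d).+1)%N
        & forall k j, (k + j = n)%N -> (size (g k) <= (j * e).+1)%N]].
Proof.
have [mu le_mu Ld] := leading_cofactor d_gt0 sL sa1' sa2'.
have alpha_inj i j : alpha *+ i = alpha *+ j -> i = j.
  by rewrite -[alpha *+ i]mulr_natr -[alpha *+ j]mulr_natr => /(mulfI alpha0) /(natrK_inj charK0).
have low : (g mu)`_(m + mu * d) != 0.
  apply: bottom_coef_neq0 => //; first by lia.
  by move=> k lt; rewrite Ld => /alpha_inj; lia.
have high j k : (k + j = n)%N -> (mu <= k)%N -> (g k)`_(j * e) != 0.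
  elim: j k => [|j IH] k ek le.
    have -> : k = n by lia.
    by rewrite gn mul0n coef1 oner_neq0.
  have nz : (g k.+1)`_(j * e) != 0 by apply: IH; lia.
  apply/eqP => z; have /esym/eqP := top_coef ek.
  rewrite z mulr0 mul0rn mulf_eq0 (negPf nz) orbF.
  by rewrite subr_eq0 Ld => /eqP /alpha_inj; lia.
have enu : (mu + (n - mu) = n)%N by lia.
have eN : (m + mu * d = (n - mu) * e)%N.
  have smu := bottom_size d_gt0 sL sa1' sa2' mu.
  have := size_eq_coef smu low.
  by rewrite (size_eq_coef (top_size enu) (high _ _ enu (leqnn _))); lia.
have mu_gt0 : (0 < mu)%N.
  rewrite lt0n; apply/eqP => mu0; move: eN; rewrite mu0 subn0 mul0n addn0 => eN.
  have e1 : (1 + n.-1 = n)%N by lia.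
  have g1nz : g 1%N != 0.
    apply/eqP => z; have : (g 1%N)`_(n.-1 * e) != 0 by apply: high; lia.
    by rewrite z coef0 eqxx.
  have L0 : L != 0.
    by apply/eqP => z; move: E0; rewrite z mul0r => /esym/cPM/eqP; rewrite (negPf g1nz).
  have : size (L * g 0%N)%R = size (g 1%N) by rewrite E0 mul_polyC size_scale.
  rewrite size_mulE ?g0_neq0 // sg0 eN.
  have := top_size e1; have : (0 < size L)%N by rewrite size_poly_gt0.
  move: e_gt0; have : (n * e = n.-1 * e + e)%N by rewrite -{1}e1 mulnDl mul1n addnC.
  lia.
have nu_gt0 : (0 < n - mu)%N.
  rewrite lt0n; apply/eqP => nu0; move: eN; rewrite nu0 => /eqP.
  by rewrite mul0n addn_eq0 muln_eq0; case/andP=> _; lia.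
case: mu le_mu Ld low high enu eN mu_gt0 nu_gt0 => // mu le_mu Ld low high.
case: (n - mu.+1)%N => // nu enu eN _ _.
exists mu, nu; split=> //.
  apply/eqP; rewrite -subr_eq0; apply/negPn/negP => nz.
  have ek : (mu + nu.+2 = n)%N by lia.
  have eq : (L - a1 *+ mu.+1) * g mu.+1
      = (g mu)^`() - a2 * g mu *+ nu.+2 + c%:P * g mu.+2 *+ mu.+2.
    by rewrite (E ek); ring.
  have smu := bottom_size d_gt0 sL sa1' sa2' mu.
  have : (size ((L - a1 *+ mu.+1) * g mu.+1)%R <= nu.+1 * e)%N.
    rewrite eq; apply: size_add_le; first apply: size_sub_le.
    - by apply: leq_trans (size_deriv_le smu) _; lia.
    - have sa2'' : (size a2 <= d.-1.+1)%N by rewrite prednK.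
      by apply/size_muln_le/(leq_trans (size_mul_le sa2'' smu)); lia.
    - apply/size_muln_le/size_C_le.
      have : (size (g mu.+2) <= (nu * e).+1)%N by apply: top_size; lia.
      by move: e_gt0; lia.
  have g1 : g mu.+1 != 0 by apply/eqP => z; move: low; rewrite z coef0 eqxx.
  rewrite size_mulE // (size_eq_coef _ low); last first.
    exact: (bottom_size d_gt0 sL sa1' sa2').
  by have : (0 < size (L - a1 *+ mu.+1)%R)%N; [rewrite size_poly_gt0 | lia].
split=> //; first by rewrite -eN.
- rewrite -eN (bottom_coef d_gt0 sL sa1' sa2'); last by lia.
  by rewrite Ld -/alpha mulrS addrK.
- rewrite top_coef //.
  by rewrite Ld -/alpha [alpha *+ mu.+2]mulrS addrK.
- by move=> k; apply: (bottom_size d_gt0 sL sa1' sa2').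
- by move=> k j; apply: top_size.
Qed.
End Matching.

(** With [M] the turning point and [N] the degree of [g M], the leading
    coefficients in the recurrence for the derivative of [g (M - 1)] give
    [(N - d) M = (M + 1) N], which is impossible. *)
Lemma dominant_a2_neq0 : a2 != 0.
Proof.
apply/eqP => a20.
have b0 : - d.+1%:R != 0 :> K by rewrite oppr_eq0 natrK_eq0.
have [mu [nu [en eN eL [C0 low high smu stop]]]] :=
  matching (ltn0Sn d) b0 (balanced_a2_eq0 a20).
move: C0 low high eN; set C := (g mu.+1)`__; set A := (g mu)`__.
set B := (g mu.+2)`__ => C0 low high eN.
have ek : (mu + nu.+2 = n)%N by lia.
have ei : ((nu * d.+1).+1 = m + mu * d)%N by lia.
have := congr1 (fun p : {poly K} => p`_(nu * d.+1)) (E ek).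
rewrite eL subrr a20 !mul0r mul0rn !add0r coef_deriv ei -/A coefN coefMn coefCM -/B => eAB.
suff /eqP : ((m + mu * d) * mu.+1)%:R == (mu.+2 * nu.+1 * d.+1)%:R :> K.
  by move/(natrK_inj charK0); rewrite -ei; lia.
have cC0 : c * C != 0 by rewrite mulf_neq0.
apply/eqP/(mulIf cC0).
transitivity ((alpha * A) *+ (m + mu * d)); first by rewrite -low; ring.
rewrite -mulrnAr eAB; transitivity (- c * (alpha * B) *+ mu.+2); first by ring.
by rewrite -high; ring.
Qed.

(** With [M] the turning point, the recurrence at [M - 1] gives [n = 2 M],
    whence [deg a2 = 0].  Eliminating with the recurrence at [M - 2], [M - 1] and
    [M] then leaves [(M + 1) c g_M' = a1 g_(M-1)'] up to lower degree, that is
    [M + 1 = M - 1] on leading coefficients. *)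
Lemma no_system_a2_lt_a1 : False.
Proof.
have a20 := dominant_a2_neq0.
pose d2 := (size a2).-1.
have s2 : size a2 = d2.+1 by rewrite prednK // size_poly_gt0.
pose e := (d - d2)%N; have de : d = (d2 + e)%N by rewrite /e; lia.
have e0 : (0 < e)%N by rewrite /e; lia.
pose beta := a2`_d2.
have b0 : beta != 0 by have := lead_coef_eq0 a2; rewrite lead_coefE s2 (negPf a20) => ->.
have [mu [nu [en eN eL [C0 low high sbot stop]]]] :=
  matching e0 b0 (balanced_a2_neq0 s2 de).
have ek : (mu + nu.+2 = n)%N by lia.
have emn : mu = nu.
  move: C0 low high; set C := (g mu.+1)`__; set A := (g mu)`__.
  set B := (g mu.+2)`__ => C0 low high.
  have ei : (nu * e = d2 + (m + mu * d))%N by lia.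
  have := congr1 (fun p : {poly K} => p`_(nu * e)) (E ek).
  rewrite eL subrr mul0r addr0 coefB !coefMn coefCM -/B.
  rewrite coef_size_le; last by apply: leq_trans (size_deriv_le (sbot mu)) _; lia.
  rewrite ei coefM_size ?s2 // -/A -/beta => eAB.
  have : (nu.+2 * mu.+1)%:R * (beta * c * C) = (mu.+2 * nu.+1)%:R * (beta * c * C).
    transitivity (beta * (alpha * A) *+ nu.+2); first by rewrite -low; ring.
    transitivity (c * (alpha * B) *+ mu.+2); last by rewrite -high; ring.
    apply/eqP; rewrite -subr_eq0; apply/eqP.
    by transitivity (alpha * (beta * A *+ nu.+2 - c * B *+ mu.+2)); [ring | rewrite -eAB mulr0].
  by move/(mulIf (mulf_neq0 (mulf_neq0 b0 c0) C0))/(natrK_inj charK0); lia.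
subst nu; have [m0 d20] : m = 0%N /\ d2 = 0%N by nia.
have ed : e = d by lia.
have a2C : a2 = beta%:P by rewrite /beta d20; apply: size1_polyC; rewrite s2 d20.
move: C0 low; rewrite ed m0 add0n; set C := (g mu.+1)`__; set A := (g mu)`__ => C0 low.
(* [w] is the coefficient [g mu.-1], read as [0] when [mu = 0]. *)
have [w [sw Ew]] : exists w : {poly K}, ((size w).+1 <= mu.+1 * d)%N /\
    w^`() = (beta%:P * w) *+ mu.+3 + a1 * g mu - c%:P * g mu.+1 *+ mu.+1.
  case: (mu) en ek eL stop sbot => [|k] en ek eL stop sbot.
    exists 0; rewrite size_poly0 linear0 mulr0 mul0rn add0r mulr1n -E0 eL mulr1n subrr.
    by split=> //; lia.
  exists (g k); split; first by have := sbot k; rewrite m0; lia.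
  rewrite (@E k k.+4) -?a2C; last by lia.
  by rewrite eL; ring.
have E1 : (g mu)^`() = beta%:P * g mu *+ mu.+2 - c%:P * g mu.+2 *+ mu.+2.
  by rewrite (E ek) eL subrr mul0r addr0 a2C.
have E2 : (g mu.+1)^`() = beta%:P * g mu.+1 *+ mu.+1 - a1 * g mu.+2 - c%:P * g mu.+3 *+ mu.+3.
  by rewrite (@E mu.+1 mu.+1) // eL a2C; ring.
pose rest := (beta%:P * (beta%:P * w) *+ mu.+3 - beta%:P * w^`()
  - c%:P * (c%:P * g mu.+3) *+ mu.+3) *+ mu.+2.
have key : c%:P * (g mu.+1)^`() *+ mu.+2 = a1 * (g mu)^`() + rest.
  by rewrite /rest Ew E1 E2; ring.
have s3 : ((size (g mu.+3)).+1 <= mu.+1 * d)%N.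
  case: (posnP mu) => [z | pos]; first by rewrite g_big ?size_poly0; lia.
  have : (size (g mu.+3) <= (mu.-1 * e).+1)%N by apply: stop; lia.
  by rewrite ed; nia.
have srest : ('X * rest)`_(mu.+1 * d) = 0.
  rewrite coefXM; case: eqP => // _; apply: coef_size_le.
  apply/size_muln_le/size_sub_le; first apply: size_sub_le.
  - by do 2! [apply: size_muln_le || apply: size_C_le]; apply: size_C_le; lia.
  - by apply: size_C_le; apply: size_deriv_le; lia.
  - by apply/size_muln_le/size_C_le/size_C_le; lia.
(* Multiplying by ['X] avoids a predecessor in the degree of a derivative. *)
have coefXD (p : {poly K}) i : ('X * p^`())`_i = p`_i *+ i.
  by case: i => [|i]; rewrite coefXM //= coef_deriv.
have sXD : (size ('X * (g mu)^`())%R <= (mu * d).+1)%N.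
  have := sbot mu; rewrite m0 add0n => s.
  apply: leq_trans (size_polyMleq _ _) _; rewrite size_polyX.
  exact: size_deriv_le.
have eCA : c * (C *+ (mu.+1 * d)) *+ mu.+2 = alpha * (A *+ (mu * d)).
  transitivity ('X * (c%:P * (g mu.+1)^`() *+ mu.+2))`_(mu.+1 * d).
    by rewrite mulrnAr mulrCA coefMn coefCM coefXD.
  rewrite key [in LHS]mulrDr coefD srest addr0 mulrCA mulSn coefM_size //.
  by rewrite coefXD.
suff : (mu.+1 * d * mu.+2)%N = (mu * d * mu.+1)%N by nia.
apply: (natrK_inj charK0); apply: (mulIf (mulf_neq0 c0 C0)).
transitivity (c * (C *+ (mu.+1 * d)) *+ mu.+2); first by ring.
by rewrite eCA mulrnAr -low; ring.
Qed.
End A1Dominant.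

Lemma darboux_system_exceptional : (1 < size a1)%N \/ (1 < size a2)%N ->
  exists2 l : K, l != 0 & a2 = l *: a1 - (l ^+ 2 * c)%:P.
Proof.
move=> big; case: (ltngtP (size a1) (size a2)) => [lt | gt | eq].
- by case: no_system_a1_lt_a2 => //; lia.
- case: (@no_system_a2_lt_a1 (size a1).-1); lia.
- by apply: system_a1_eq_a2 => //; lia.
Qed.

End DarbouxSystem.

(** * Primitive polynomials and Gauss's lemma *)

Section Gauss.
Variable K : fieldType.
Implicit Types (p d : {poly K}) (f g q : {poly {poly K}}).

Lemma irreducible_factor p : (1 < size p)%N ->
  exists2 q : {poly K}, q %| p & irreducible_poly q.
Proof.
elim: {p}_.+1 {-2}p (ltnSn (size p)) => // s IH p lt gt1.
have p0 : p != 0 by rewrite -size_poly_gt0; lia.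
have [[q [q1 dv ne]] | none] :=
    pselect (exists q : {poly K}, [/\ size q != 1, q %| p & ~~ (q %= p)]); last first.
  exists p => //; split=> // q q1 dv; apply/negPn/negP => ne.
  by apply: none; exists q.
have le : (size q <= size p)%N by apply: dvdp_leq.
have neq : size q != size p by apply: contra ne => es; rewrite -dvdp_size_eqp.
have q0 : q != 0 by apply: contraTneq dv => ->; rewrite dvd0p.
have sq0 : (0 < size q)%N by rewrite size_poly_gt0.
have [||r rq irr] := IH q; [lia | lia |].
by exists r => //; apply: dvdp_trans rq dv.
Qed.

Lemma dvd_coefs_dichotomy p f :
  (forall i, p %| f`_i) \/
  exists2 i, ~~ (p %| f`_i) & forall j, (j < i)%N -> p %| f`_j.
Proof.
have [[i ndv] | all] := pselect (exists i, ~~ (p %| f`_i)); last first.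
  by left=> i; apply/negPn/negP => ndv; apply: all; exists i.
right; have ex : exists i, ~~ (p %| f`_i) by exists i.
case: (ex_minnP ex) => k ndvk min; exists k => // j lt.
by apply/negPn/negP => /min; lia.
Qed.

(** Gauss's lemma: the product of the first coefficients of [f] and of [g] that
    are not divisible by [p] is the only such term in its coefficient of
    [f * g]. *)
Lemma irreducible_dvd_coefsM p f g : irreducible_poly p ->
  (forall i, p %| (f * g)`_i) -> (forall i, p %| f`_i) \/ (forall i, p %| g`_i).
Proof.
move=> irr dv; have [?|[i ndvf minf]] := dvd_coefs_dichotomy p f; first by left.
have [?|[j ndvg ming]] := dvd_coefs_dichotomy p g; first by right.
have hi : (i < (i + j).+1)%N by lia.
have := dv (i + j)%N; rewrite coefM (bigD1 (Ordinal hi)) //= addKn.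
rewrite dvdp_addl.
  by rewrite Gauss_dvdpl ?(negPf ndvf) // irreducible_poly_coprime.
apply: (big_ind (fun r : {poly K} => p %| r)) => [|q r|k ne]; rewrite ?dvdp0 //.
  exact: dvdp_add.
have {}ne : nat_of_ord k <> i.
  by move=> e; case/eqP: ne; apply: val_inj.
have [lt | ge] := ltnP k i; first by rewrite dvdp_mulr ?minf.
by rewrite dvdp_mull // ming //; have := ltn_ord k; lia.
Qed.

Lemma dvd_coefsP p f : (forall i, p %| f`_i) -> exists h : {poly {poly K}}, f = p%:P * h.
Proof.
move=> dv; exists (map_poly (fun q : {poly K} => q %/ p) f).
apply/polyP=> i; rewrite coefCM coef_map_id0 ?div0p // mulrC divpK //.
Qed.

Definition primitive f := forall p, (1 < size p)%N -> ~ forall i, p %| f`_i.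

(** Each irreducible factor of [p] divides [q], since it cannot divide [g]. *)
Lemma primitive_cancel p f g q : p != 0 -> primitive g ->
  p%:P * f = q * g -> exists h : {poly {poly K}}, f = h * g.
Proof.
elim: {p}_.+1 {-2}p q (ltnSn (size p)) => // s IH p q lt p0 prim e.
have [gt1 | le1] := ltnP 1 (size p); last first.
  have := size1_polyC le1; set k := p`_0 => pk; rewrite pk in p0 e.
  have k0 : k != 0 by rewrite polyC_eq0 in p0.
  exists ((k^-1)%:P%:P * q); rewrite -mulrA -e mulrA -!polyCM mulVf // mul1r //.
have [r rp irr] := irreducible_factor gt1.
have r0 := irredp_neq0 irr.
have [|dvq|dvg] := @irreducible_dvd_coefsM r q g irr.
- by move=> i; rewrite -e coefCM dvdp_mulr.
- have [q' eq'] := dvd_coefsP dvq.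
  have pE := divpK rp; set p' : {poly K} := p %/ r in pE.
  rewrite -pE in p0 e lt.
  have p'0 : p' != 0 by apply: contraNneq p0 => ->; rewrite mul0r.
  apply: (IH p' q') => //.
    have gtr : (1 < size r)%N := irr.1.
    have p'gt0 : (0 < size p')%N by rewrite size_poly_gt0.
    by move: lt; rewrite size_mulE //; lia.
  apply: (mulfI (_ : r%:P != 0)); first by rewrite polyC_eq0.
  by rewrite [RHS]mulrA -eq' -e polyCM; ring.
- by case: (prim r irr.1).
Qed.

Lemma primitive_part f : f != 0 ->
  exists (d : {poly K}) (g : {poly {poly K}}), [/\ d != 0, f = d%:P * g & primitive g].
Proof.
elim: {f}_.+1 {-2}f (ltnSn (size (lead_coef f))) => // s IH f lt f0.
have [[p [gt1 dv]] | none] :=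
    pselect (exists p : {poly K}, (1 < size p)%N /\ forall i, p %| f`_i); last first.
  exists 1, f; split; [exact: oner_neq0 | by rewrite mul1r |].
  by move=> p gt1 dv; apply: none; exists p.
have [h fE] := dvd_coefsP dv; have p0 : p != 0 by rewrite -size_poly_gt0; lia.
have h0 : h != 0 by apply: contraNneq f0 => h0; rewrite fE h0 mulr0.
have [||d [g [d0 hE prim]]] := IH h => //.
  have lE : lead_coef f = p * (lead_coef h : {poly K}) by rewrite fE lead_coefM lead_coefC.
  move: lt; rewrite lE size_mulE ?lead_coef_eq0 //.
  have : (0 < size (lead_coef h : {poly K}))%N by rewrite size_poly_gt0 lead_coef_eq0.
  by move: (lead_coef f) (lead_coef h) gt1 => u v; lia.
exists (p * d), g; split=> //; first by rewrite mulf_neq0.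
by rewrite fE hE polyCM mulrA.
Qed.

End Gauss.

(** * The derivation in coordinates *)

Section Derivation.
Variable K : fieldType.
Hypothesis charK0 : [pchar K] =i pred0.
Variables a0 a1 a2 : {poly K}.
Implicit Types f g p : {poly {poly K}}.

Local Notation D := (quadratic_derivation a0 a1 a2).

Lemma derivationM f g : D (f * g) = D f * g + f * D g.
Proof. exact: (quadratic_derivation_is_derivation a0 a1 a2).2. Qed.

Lemma derivation_coef0 f : (D f)`_0 = a0 * f`_1.
Proof.
rewrite /quadratic_derivation /partial_y !mulrDl !coefD -!mulrA !coefCM.
by rewrite !coefXM coef_deriv mulr1n !mulr0 !add0r.
Qed.

Lemma derivation_coefS f k : (D f)`_k.+1 =
  (f`_k)^`() + a2 * f`_k *+ k + a1 * f`_k.+1 *+ k.+1 + a0 * f`_k.+2 *+ k.+2.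
Proof.
rewrite /quadratic_derivation /partial_y !mulrDl !coefD -!mulrA !coefCM.
rewrite !coefXM /= partial_xE !coef_deriv !mulrnAr !addrA.
by case: k => [|k] /=; rewrite ?coefXM ?coef_deriv ?mulrnAr ?mulr0.
Qed.

Lemma derivation_polyC (p : {poly K}) : D p%:P = (p^`())%:P * 'X.
Proof.
apply/polyP=> -[|k]; rewrite ?derivation_coef0 ?derivation_coefS coefMX !coefC.
  by rewrite mulr0.
by case: k => [|k]; rewrite /= !(mulr0, mulr0n, mul0rn, addr0, linear0).
Qed.

Lemma size_derivation f : (size (D f) <= (size f).+1)%N.
Proof.
apply/leq_sizeP => -[|j]; rewrite ?ltn0 // ltnS => le.
have z k : (j <= k)%N -> f`_k = 0 by move=> jk; apply/nth_default/(leq_trans le).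
by rewrite derivation_coefS !z ?linear0 ?(mulr0, mul0rn, addr0) //; lia.
Qed.

(** The cofactor has degree at most [1] in [y].  In the top degree of [y], with
    [M] the coefficient of [y] in the cofactor and [n] the degree of [g], one
    finds [g_n' = (M - n a2) g_n], so both sides vanish by comparing degrees;
    hence [g_n] is a constant and can be divided out. *)
Lemma darboux_to_system c g lam : a0 = c%:P -> (1 < size g)%N -> D g = lam * g ->
  exists L h, darboux_system c a1 a2 L (size g).-1 h.
Proof.
move=> a0E gt1 eD; set n := (size g).-1.
have sg : size g = n.+1 by rewrite /n; lia.
have g0 : g != 0 by rewrite -size_poly_gt0; lia.
have slam : (size lam <= 2)%N.
  have [-> | l0] := eqVneq lam 0; first by rewrite size_poly0.
  have sM : size (lam * g) = (size lam + size g).-1 by exact: size_mul.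
  by have := size_derivation g; rewrite eD sM sg; lia.
have lamE : lam = (lam`_0)%:P + (lam`_1)%:P * 'X.
  apply/polyP=> i; rewrite coefD coefMX !coefC.
  case: i => [|[|i]] /=; rewrite ?addr0 ?add0r //.
  by apply/nth_default/(leq_trans slam).
set L := lam`_0 in lamE; set M := lam`_1 in lamE.
have C0 : c%:P * g`_1 = L * g`_0.
  by rewrite -a0E -derivation_coef0 eD lamE mulrDl coefD coefCM -mulrA coefCM coefXM mulr0 addr0.
have CS k : (g`_k)^`() + a2 * g`_k *+ k + a1 * g`_k.+1 *+ k.+1 + c%:P * g`_k.+2 *+ k.+2
    = L * g`_k.+1 + M * g`_k.
  by rewrite -a0E -derivation_coefS eD lamE mulrDl coefD coefCM -mulrA coefCM coefXM.
have gz k : (n < k)%N -> g`_k = 0 by move=> lt; rewrite nth_default // sg.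
have gn0 : g`_n != 0 by have := lead_coef_eq0 g; rewrite lead_coefE sg (negPf g0) => ->.
have top : (g`_n)^`() = (M - a2 *+ n) * g`_n.
  have := CS n; rewrite (gz n.+1) // (gz n.+2) // !(mulr0, mul0rn, addr0, add0r).
  by move=> e; rewrite mulrBl -e; ring.
have ME : M = a2 *+ n.
  apply/eqP; rewrite -subr_eq0; apply/negPn/negP => nz.
  have := lt_size_deriv gn0; rewrite top size_mulE //.
  have : (0 < size (M - a2 *+ n)%R)%N by rewrite size_poly_gt0.
  lia.
have [k k0 gnE] : exists2 k : K, k != 0 & g`_n = k%:P.
  apply/size_poly1P/eqP; have := size_deriv_char0 charK0 (g`_n).
  rewrite top ME subrr mul0r size_poly0.
  by have : (0 < size (g`_n)%R)%N; [rewrite size_poly_gt0 | lia].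
exists L, (fun i : nat => (k^-1)%:P * g`_i); split.
- by rewrite gnE -polyCM mulVf.
- by move=> i lt; rewrite gz // mulr0.
- by rewrite [RHS]mulrCA C0; ring.
move=> i j ij; rewrite derivM derivC mul0r add0r.
have -> : (g`_i)^`() = L * g`_i.+1 + M * g`_i - a2 * g`_i *+ i
    - a1 * g`_i.+1 *+ i.+1 - c%:P * g`_i.+2 *+ i.+2.
  by rewrite -CS; ring.
by rewrite ME -ij mulrnDr; ring.
Qed.

End Derivation.

(** * Stable ideals *)

Section Simplicity.
Variable K : fieldType.
Hypothesis charK0 : [pchar K] =i pred0.
Variables a0 a1 a2 : {poly K}.
Implicit Types f g : {poly {poly K}}.

Local Notation D := (quadratic_derivation a0 a1 a2).
Local Notation DM := (derivationM a0 a1 a2).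

Lemma derivationD f g : D (f + g) = D f + D g.
Proof.
have := (quadratic_derivation_is_derivation a0 a1 a2).1 1 f g.
by rewrite polyC1 !scale1r.
Qed.

Lemma derivationB f g : D (f - g) = D f - D g.
Proof.
have := (quadratic_derivation_is_derivation a0 a1 a2).1 (-1) g f.
by rewrite polyCN polyC1 !scaleN1r addrC => ->; rewrite addrC.
Qed.

Definition radical (I : set {poly {poly K}}) : set {poly {poly K}} :=
  [set f | exists k, I (f ^+ k)]%classic.

Lemma radical_ideal I : is_ideal I -> is_ideal (radical I).
Proof.
case=> I0 ID IM; split; first by exists 1%N; rewrite expr1.
  move=> f g [k Ik] [l Il]; exists (k + l)%N; rewrite exprDn.
  apply: (big_ind I) => // i _; rewrite -mulr_natr mulrC; apply: (IM).
  have [le | lt] := leqP l i.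
    by rewrite -(subnK le) exprD mulrA; apply: (IM).
  rewrite mulrC (_ : (k + l - i)%N = (k + l - i - k + k)%N); last by lia.
  by rewrite exprD mulrA; apply: (IM).
move=> r f [k Ik]; exists k; rewrite exprMn; exact: (IM).
Qed.

Lemma derivationX_mul f k : D (f ^+ k) * f = f ^+ k * D f *+ k.
Proof.
elim: k => [|k IH].
  by rewrite expr0 -[1]polyC1 derivation_polyC -polyC1 derivC !mul0r mulr0n.
by rewrite exprS DM mulrDl -[f * _ * f]mulrA IH; ring.
Qed.

(** Starting from [f ^ k], differentiating and multiplying by [D f] replaces one
    factor [f] by [(D f) ^ 2], up to a positive integer that is invertible in
    characteristic zero; after [k] steps only a power of [D f] is left. *)
Lemma radical_stable I : is_ideal I -> stable D I -> stable D (radical I).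
Proof.
move=> [_ ID IM] stI _ [f [k Ik] <-]; exists k.*2.
have IDer g : I g -> I (D g) by move=> Ig; apply: stI; exists g.
suff W j i : (j + i = k)%N -> I (f ^+ j * D f ^+ i.*2).
  by have := W 0%N k (add0n k); rewrite mul1r.
elim: i j => [|i IH] j e; first by rewrite mulr1 (_ : j = k) //; lia.
have If : I (f ^+ j.+1 * D f ^+ i.*2) by apply: (IH); lia.
have -> : f ^+ j * D f ^+ i.+1.*2 = (j.+1%:R^-1)%:P%:P *
    (D f * D (f ^+ j.+1 * D f ^+ i.*2)
     - (D (D f)) *+ i.*2 * (f ^+ j.+1 * D f ^+ i.*2)).
  transitivity ((j.+1%:R^-1 * j.+1%:R)%:P%:P * (f ^+ j * D f ^+ i.+1.*2)).
    by rewrite mulVf ?mul1r // natrK_eq0.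
  rewrite 2!polyCM -[LHS]mulrA; congr (_ * _).
  transitivity (f ^+ j * D f ^+ i.+1.*2 *+ j.+1); first by rewrite !rmorph_nat mulr_natl.
  have Df : D (f ^+ j.+1) = f ^+ j * D f *+ j.+1.
    by rewrite exprSr DM derivationX_mul; ring.
  have := derivationX_mul (D f) i.*2; rewrite DM Df.
  move: (D (D f ^+ i.*2)) => w ew; apply/eqP; rewrite -subr_eq0; apply/eqP.
  transitivity (f ^+ j.+1 * (D f ^+ i.*2 * D (D f) *+ i.*2 - w * D f)).
    by rewrite doubleS !exprS; ring.
  by rewrite ew subrr mulr0.
apply: (IM); rewrite -mulNr; apply: (ID); last exact: (IM).
by apply/IM/IDer.
Qed.

Section RadicalStableIdeal.
Variable I : set {poly {poly K}}.
Hypotheses (idI : is_ideal I) (stI : stable D I)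
  (radI : forall f, I (f * f) -> I f).

Let ID f g : I f -> I g -> I (f + g). Proof. by case: idI => _ + _; apply. Qed.
Let IM r f : I f -> I (r * f). Proof. by case: idI => _ _; apply. Qed.
Let IB f g : I f -> I g -> I (f - g).
Proof. by move=> If Ig; apply: (ID) => //; rewrite -mulN1r; apply: (IM). Qed.
Let IDer f : I f -> I (D f). Proof. by move=> If; apply: stI; exists f. Qed.

(** [D p = p' y] and [D (p' y) = c p' + p'' y ^ 2] modulo [p' y]; multiplying by
    [p'] turns the last term into a multiple of [p' y], so that [p' ^ 2] lies in
    [I], and so does [p'] because [I] is radical. *)
Lemma stable_ideal_polyC c (p : {poly K}) : c != 0 -> a0 = c%:P -> p != 0 ->
  I p%:P -> I 1.
Proof.
move=> c0 a0E; elim: {p}_.+1 {-2}p (ltnSn (size p)) => // s IH p lt p0 Ip.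
have [gt1 | le1] := ltnP 1 (size p); last first.
  have := size1_polyC le1; set k := p`_0 => pk; rewrite pk polyC_eq0 in p0.
  by have := IM ((k^-1)%:P%:P) Ip; rewrite pk -!polyCM mulVf.
have sp' := size_deriv_char0 charK0 p.
apply: (IH p^`()); first by move: lt; rewrite sp'; lia.
  by rewrite -size_poly_gt0 sp'; lia.
have Iyp' : I ((p^`())%:P * 'X) by rewrite -(derivation_polyC a0 a1 a2); apply: IDer.
apply: radI.
have -> : (p^`())%:P * (p^`())%:P = (c^-1)%:P%:P * ((p^`())%:P * D ((p^`())%:P * 'X)
    - ((p^`()^`())%:P * 'X + (a2%:P * 'X + a1%:P) * (p^`())%:P) * ((p^`())%:P * 'X)).
  rewrite DM derivation_polyC quadratic_derivation_y a0E.
  rewrite [X in _ = _ * X](_ : _ = c%:P%:P * ((p^`())%:P * (p^`())%:P)); last by ring.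
  by rewrite mulrA -[(c^-1)%:P%:P * _]polyCM -[(c^-1)%:P * _]polyCM mulVf // mul1r.
by apply/IM/IB; apply: (IM) => //; apply: IDer.
Qed.

(** Division of [D g] by [g] lowers the degree in [y], except when the primitive
    part of [g] is a Darboux polynomial. *)
Lemma stable_ideal_unit c g : c != 0 -> a0 = c%:P ->
  (forall f lam : {poly {poly K}}, (1 < size f)%N -> D f = lam * f -> False) ->
  g != 0 -> I g -> I 1.
Proof.
move=> c0 a0E noD; elim: {g}_.+1 {-2}g (ltnSn (size g)) => // s IH g lt g0 Ig.
have := Pdiv.Idomain.divp_eq (D g) g.
set k := lead_coef g ^+ _; set q := (D g) %/ g; set r := (D g) %% g => e.
have k0 : k != 0 by rewrite expf_neq0 // lead_coef_eq0.
have sr : (size r < size g)%N by rewrite ltn_modp.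
have Ir : I r.
  have -> : r = k%:P * D g - q * g by rewrite mul_polyC e; ring.
  by apply: IB; apply: (IM) => //; apply: IDer.
have [r0 | nz] := eqVneq r 0; last by apply: (IH r) => //; apply: leq_trans sr _.
move: e; rewrite r0 addr0 -mul_polyC => e.
have [d [h [d0 gE prim]]] := primitive_part g0.
have [lam Dh] : exists lam : {poly {poly K}}, D h = lam * h.
  apply: (primitive_cancel (p := k * d)
    (q := q * d%:P - k%:P * (d^`())%:P * 'X)) => //; first exact: mulf_neq0.
  have : k%:P * D (d%:P * h) = q * (d%:P * h) by rewrite -gE.
  rewrite DM derivation_polyC => e'; rewrite polyCM -mulrA.
  transitivity (k%:P * ((d^`())%:P * 'X * h + d%:P * D h)
    - k%:P * (d^`())%:P * 'X * h); first by ring.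
  by rewrite e'; ring.
have [gt1 | le1] := ltnP 1 (size h); first by case: (noD h lam gt1 Dh).
have hE := size1_polyC le1; rewrite hE -polyCM in gE.
apply: (stable_ideal_polyC c0 a0E (p := d * h`_0)); last by rewrite -gE.
by rewrite -polyC_eq0 -gE.
Qed.

End RadicalStableIdeal.

Lemma simple_of_no_darboux c : c != 0 -> a0 = c%:P ->
  (forall f lam : {poly {poly K}}, (1 < size f)%N -> D f = lam * f -> False) ->
  simple_derivation D.
Proof.
move=> c0 a0E noD; split; first exact: quadratic_derivation_is_derivation.
move=> I idI stI; have [I0 _ IM] := idI.
have [[g [g0 Ig]] | none] := pselect (exists g, g != 0 /\ I g); last first.
  left; apply/seteqP; split=> [f If /= | f /= -> //].
  by apply/eqP/negPn/negP => f0; apply: none; exists f.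
right; apply/seteqP; split=> // f _.
suff [k] : radical I 1 by rewrite expr1n => I1; rewrite -[f]mulr1; apply: (IM).
apply: (stable_ideal_unit (radical_ideal idI) (radical_stable idI stI) _ c0 a0E noD g0).
  by move=> h [k Ik]; exists k.*2; rewrite -mul2n exprM expr2.
by exists 1%N; rewrite expr1.
Qed.

Lemma simple_darboux_unit f (lam : {poly {poly K}}) : simple_derivation D -> D f = lam * f ->
  f != 0 -> exists r, r * f = 1.
Proof.
move=> [_ simple] Df f0.
have [||I0|IT] := simple [set g | exists r, r * f = g]%classic.
- split=> [|g h [r <-] [s <-]|t g [r <-]]; first by exists 0; rewrite mul0r.
    by exists (r + s); rewrite mulrDl.
  by exists (t * r); rewrite mulrA.
- move=> _ [g [r <-] <-]; exists (D r + r * lam).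
  by rewrite DM Df; ring.
- have : [set 0]%classic f by rewrite -I0; exists 1; rewrite mul1r.
  by move=> /= f0'; rewrite f0' eqxx in f0.
- by have : [set: {poly {poly K}}]%classic 1 by []; rewrite -IT.
Qed.

Lemma simple_darboux_size f (lam : {poly {poly K}}) : simple_derivation D -> D f = lam * f ->
  f != 0 -> size f = 1.
Proof.
move=> simple Df f0; have [r rf] := simple_darboux_unit simple Df f0.
have /eqP : size (r * f) = 1 by rewrite rf size_poly1.
have r0 : r != 0 by apply: contra_eq_neq rf => ->; rewrite mul0r eq_sym oner_eq0.
by rewrite size_mul_eq1 => /andP[_ /eqP].
Qed.

(** * Necessity of the three conditions *)

(** The constant term of [D f] is [a0] times the coefficient of [y] in [f], so
    the ideal generated by [y] and [a0] is stable. *)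
Lemma simple_a0_unit : simple_derivation D -> exists2 c : K, c != 0 & a0 = c%:P.
Proof.
move=> [_ simple].
have [||I0|IT] := simple [set f | a0 %| f`_0]%classic.
- split=> [|f g /= df dg|r f /= df]; first by rewrite /= coef0 dvdp0.
    by rewrite coefD dvdp_add.
  by rewrite coef0M dvdp_mull.
- by move=> _ [f _ <-] /=; rewrite derivation_coef0 dvdp_mulr.
- have : [set 0]%classic ('X : {poly {poly K}}) by rewrite -I0 /= coefX dvdp0.
  by move=> /= /eqP; rewrite polyX_eq0.
- have : [set: {poly {poly K}}]%classic 1 by [].
  rewrite -IT /= coef1 dvdp1 => /size_poly1P [c c0 ->]; by exists c.
Qed.

(** When [a1] and [a2] are constants, [D y] is a polynomial in [y] alone, so
    [D (D y)] is a multiple of [D y].  This leaves [a1 = a2 = 0], where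
    [y ^ 2 - 2 c x] is a constant of [D]. *)
Lemma simple_nonconstant c : simple_derivation D -> c != 0 -> a0 = c%:P ->
  (1 < size a1)%N \/ (1 < size a2)%N.
Proof.
move=> simple c0 a0E; apply/orP; rewrite -[_ || _]negbK negb_or -!leqNgt.
apply/negP => /andP[s1 s2].
have d1 : a1^`() = 0 by rewrite (size1_polyC s1) derivC.
have d2 : a2^`() = 0 by rewrite (size1_polyC s2) derivC.
have d0 : a0^`() = 0 by rewrite a0E derivC.
have coefD_X i : (D 'X)`_i = a2 *+ (i == 2) + a1 *+ (i == 1%N) + a0 *+ (i == 0%N).
  rewrite quadratic_derivation_y !coefD !coefCM coefXn coefX coefC.
  by rewrite !mulr_natr; case: (i == 0%N).
have DDX : D (D 'X) = (a2%:P *+ 2 * 'X + a1%:P) * D 'X.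
  rewrite {1}quadratic_derivation_y !derivationD expr2 !DM !derivation_polyC.
  by rewrite d0 d1 d2; ring.
have DX0 : D 'X != 0.
  apply/eqP => /(congr1 (fun f : {poly {poly K}} => f`_0)) /eqP.
  by rewrite coefD_X coef0 !mulr0n !add0r a0E polyC_eq0 (negPf c0).
have sDX := simple_darboux_size simple DDX DX0.
have z i : (0 < i)%N -> (D 'X)`_i = 0 by move=> i0; rewrite nth_default ?sDX.
have a10 : a1 = 0 by have := z 1%N isT; rewrite coefD_X !mulr0n add0r addr0.
have a20 : a2 = 0 by have := z 2%N isT; rewrite coefD_X !mulr0n !addr0.
pose f : {poly {poly K}} := 'X * 'X - (c%:P * 'X *+ 2)%:P.
have Df : D f = 0 * f.
  rewrite /f derivationB DM derivation_polyC quadratic_derivation_y a10 a20 a0E.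
  by rewrite derivMn derivM derivC derivX; ring.
have f2 : f`_2 = 1 by rewrite coefB coefC coefXM coefX subr0.
have f0 : f != 0 by apply: contra_eq_neq f2 => ->; rewrite coef0 eq_sym oner_eq0.
have sf := simple_darboux_size simple Df f0.
by have /eqP := f2; rewrite nth_default ?sf // eq_sym oner_eq0.
Qed.

(** [1 + l y] is a Darboux polynomial under the excluded relation. *)
Lemma simple_not_exceptional l : simple_derivation D -> l != 0 ->
  a2 <> l *: a1 - l ^+ 2 *: a0.
Proof.
move=> simple l0 a2E.
pose f : {poly {poly K}} := 1 + l%:P%:P * 'X.
have Df : D f = l%:P%:P * (a1%:P * 'X + a0%:P * (1 - l%:P%:P * 'X)) * f.
  rewrite /f derivationD DM -polyC1 !derivation_polyC !derivC quadratic_derivation_y a2E.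
  by rewrite -!mul_polyC !(polyCB, polyCM) -polyC1; ring.
have f1 : f`_1 = l%:P by rewrite coefD coef1 add0r coefCM coefX mulr1.
have f0 : f != 0.
  by apply: contra_neq l0 => f0; apply/polyC_inj; rewrite -f1 f0 coef0.
have sf := simple_darboux_size simple Df f0.
by have /eqP := f1; rewrite nth_default ?sf // eq_sym polyC_eq0 (negPf l0).
Qed.

End Simplicity.

Theorem theorem4p2 (K : fieldType) (charK0 : [pchar K] =i pred0)
    (a0 a1 a2 : {poly K}) :
  simple_derivation (quadratic_derivation a0 a1 a2) <->
  [/\ exists2 c : K, c != 0 & a0 = c%:P,
      (1 < size a1)%N \/ (1 < size a2)%N
    & ~ exists2 l : K, l != 0 & a2 = l *: a1 - l ^+ 2 *: a0].
Proof.
have DM := derivationM a0 a1 a2.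
split=> [simple | [[c c0 a0E] big nol]]; last first.
  apply: (simple_of_no_darboux charK0 c0 a0E) => f lam gt1 Df.
  have [L [g sys]] := darboux_to_system charK0 a0E gt1 Df.
  have n0 : (0 < (size f).-1)%N by lia.
  have [l l0 a2E] := darboux_system_exceptional charK0 c0 n0 sys big.
  by apply: nol; exists l; rewrite // a2E a0E -[_ *: c%:P]mul_polyC -polyCM.
have [c c0 a0E] := simple_a0_unit simple.
split; [by exists c | exact: (simple_nonconstant simple c0) |].
by move=> [l l0 a2E]; apply: (simple_not_exceptional simple l0 a2E).
Qed.
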